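(* For a semigroup $S$ the following conditions are equivalent: (1) $S$ is a left regular semigroup; (2) for every intuitionistic fuzzy left ideal $A=(\mu_A,\nu_A)$ of $S$, the intuitionistic fuzzy magnified translation $A^C_{\beta\alpha}=((\mu_A)^C_{\beta\alpha},(\nu_A)^C_{\beta\alpha})$ of $A$ (where $\beta\in(0,1]$ and $\alpha\in[0,\inf\{\beta\nu_A(x):x\in S\}]$) is an intuitionistic fuzzy semiprime ideal of $S$.
   Context: A semigroup is a non-empty set with an associative binary operation. $S$ is left regular if for each $a\in S$ there exists $x\in S$ with $a=xa^2$. An intuitionistic fuzzy subset of $S$ is a pair $A=(\mu_A,\nu_A)$ of functions $\mu_A,\nu_A:S\to[0,1]$ with $0\le\mu_A(x)+\nu_A(x)\le1$ for all $x\in S$; it is non-empty if it is not the empty one ($\mu_A\equiv0$, $\nu_A\equiv1$). For $\beta\in(0,1]$ and $\alpha\in[0,\inf\{\beta\nu_A(x):x\in S\}]$, the intuitionistic fuzzy magnified translation of $A$ is $A^C_{\beta\alpha}=((\mu_A)^C_{\beta\alpha},(\nu_A)^C_{\beta\alpha})$ with $(\mu_A)^C_{\beta\alpha}(x)=\beta\mu_A(x)+\alpha$ and $(\nu_A)^C_{\beta\alpha}(x)=\beta\nu_A(x)-\alpha$ for all $x\in S$. A non-empty intuitionistic fuzzy subset $A$ of $S$ is an intuitionistic fuzzy left ideal if $\mu_A(xy)\ge\mu_A(y)$ and $\nu_A(xy)\le\nu_A(y)$ for all $x,y\in S$, and an intuitionistic fuzzy right ideal if $\mu_A(xy)\ge\mu_A(x)$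 and $\nu_A(xy)\le\nu_A(x)$ for all $x,y\in S$. It is an intuitionistic fuzzy ideal (two-sided) if it is both an intuitionistic fuzzy left ideal and an intuitionistic fuzzy right ideal. An intuitionistic fuzzy ideal $A$ of $S$ is an intuitionistic fuzzy semiprime ideal if $\mu_A(x)\ge\mu_A(x^2)$ and $\nu_A(x)\le\nu_A(x^2)$ for all $x\in S$.
   Formalization: In (2), ''semiprime ideal'' is read as semiprime left ideal (the right-ideal inequalities are dropped): with two-sided ideals (1)⇒(2) fails, e.g. for the right zero semigroup {a,b}, A the characteristic pair of {a}, β=1, α=0. *)

(* Defs.v *)
From HB Require Import structures.
From mathcomp Require Import all_boot all_order all_algebra.
From mathcomp Require Import all_classical all_reals.

Set Implicit Arguments.
Unset Strict Implicit.
Unset Printing Implicit Defensive.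

Import Order.TTheory GRing.Theory Num.Theory.

Local Open Scope ring_scope.
Local Open Scope classical_set_scope.

Definition left_regular (S : semigroupType) : Prop :=
  forall a : S, exists x : S, a = (x * (a * a))%g.

(* A bare pair of real functions; the bounds are the predicate [is_ifs], so that
   the magnified translation below needs no proof arguments. *)
Record ifpair (R : realType) (S : Type) : Type :=
  IFPair { mu : S -> R ; nu : S -> R }.

Section IntuitionisticFuzzy.
Variables (R : realType) (S : semigroupType).
Implicit Types (A : ifpair R S) (beta alpha : R).

Definition is_ifs A : Prop :=
  forall x, [/\ 0 <= mu A x <= 1, 0 <= nu A x <= 1
             & 0 <= mu A x + nu A x <= 1].

Definition if_nonempty A : Prop :=
  ~ ((forall x, mu A x = 0) /\ (forall x, nu A x = 1)).

Definition if_left_ideal A : Prop :=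
  [/\ is_ifs A, if_nonempty A
    & forall x y, mu A y <= mu A (x * y)%g /\ nu A (x * y)%g <= nu A y].

Definition if_semiprime A : Prop :=
  forall x, mu A (x * x)%g <= mu A x /\ nu A x <= nu A (x * x)%g.

(* One-sided on purpose: translations of left ideals need not be right ideals,
   even when S is left regular. In the right zero semigroup {a, b} (xy = y),
   which is left regular, the characteristic pair of {a} is a left ideal but
   not a right ideal, and it is its own translation for beta = 1, alpha = 0. *)
Definition if_semiprime_left_ideal A : Prop :=
  if_left_ideal A /\ if_semiprime A.

Definition magnified_translation beta alpha A : ifpair R S :=
  IFPair (fun x => beta * mu A x + alpha) (fun x => beta * nu A x - alpha).

Definition translation_params A beta alpha : Prop :=
  0 < beta <= 1 /\ 0 <= alpha <= inf (range (fun x => beta * nu A x)).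

End IntuitionisticFuzzy.

(* Main.v *)
(* A magnified translation of a left ideal is again a left ideal; its bounds hold
   because alpha <= beta * nu A x for every x. If a = x a^2, a left ideal
   satisfies mu a >= mu (a^2) and nu a <= nu (a^2). Conversely, semiprimeness
   (at beta = 1, alpha = 0) of the characteristic pair of the principal left
   ideal {a^2} U S a^2 puts a in that ideal, and a = a^2 also gives
   a = a a^2. *)
Require Import Defs.
From HB Require Import structures.
From mathcomp Require Import all_boot all_order all_algebra.
From mathcomp Require Import all_classical all_reals.
From mathcomp Require Import lra.

Set Implicit Arguments.
Unset Strict Implicit.
Unset Printing Implicit Defensive.

Import Order.TTheory GRing.Theory Num.Theory.

Local Open Scope ring_scope.
Local Open Scope classical_set_scope.

Lemma translation_params_le (R : realType) (S : semigroupType)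
    (A : ifpair R S) (beta alpha : R) :
  is_ifs A -> translation_params A beta alpha ->
  forall x, alpha <= beta * nu A x.
Proof.
move=> Aifs [/andP[beta0 _] /andP[_ le_inf]] x.
apply: (le_trans le_inf); apply: ge_inf; last by exists x.
(* [ge_inf] asks for a lower bound of the range; 0 is one, since beta and nu are nonnegative. *)
exists 0 => _ [y _ <-].
by case: (Aifs y) => _ /andP[nu0 _] _; rewrite mulr_ge0 // ltW.
Qed.

Lemma magnified_translation_ifs (R : realType) (S : semigroupType)
    (A : ifpair R S) (beta alpha : R) :
  is_ifs A -> translation_params A beta alpha ->
  is_ifs (magnified_translation beta alpha A).
Proof.
move=> Aifs pars x; have le_alpha := translation_params_le Aifs pars x.
case: pars => /andP[beta0 beta1] /andP[alpha0 _].
case: (Aifs x) => /andP[mu0 mu1] /andP[nu0 nu1] /andP[_ sum1] /=.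
have bmu0 : 0 <= beta * mu A x by rewrite mulr_ge0 // ltW.
have bnu0 : 0 <= beta * nu A x by rewrite mulr_ge0 // ltW.
(* This caps the translated mu: beta mu + alpha <= beta mu + beta nu <= beta <= 1. In the sum of
   both components alpha cancels. *)
have bsum1 : beta * (mu A x + nu A x) <= beta.
  by rewrite ler_piMr // ltW.
by rewrite mulrDr in bsum1; split; apply/andP; split; lra.
Qed.

(** If beta mu + alpha = 0, both nonnegative terms vanish, so mu = 0. If beta nu - alpha = 1, then 1
    <= 1 + alpha = beta nu <= nu <= 1, so nu = 1. Hence only the empty pair could have an empty
    translation. *)
Lemma magnified_translation_nonempty (R : realType) (S : semigroupType)
    (A : ifpair R S) (beta alpha : R) :
  is_ifs A -> if_nonempty A -> translation_params A beta alpha ->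
  if_nonempty (magnified_translation beta alpha A).
Proof.
move=> Aifs Ane [/andP[beta0 beta1] /andP[alpha0 _]] [/= tmu0 tnu1].
apply: Ane; split=> x; case: (Aifs x) => /andP[mu0 _] /andP[nu0 nu1] _.
  have bmu0 := mulr_ge0 (ltW beta0) mu0.
  have /eqP : beta * mu A x = 0 by have := tmu0 x; lra.
  by rewrite mulf_eq0 gt_eqF //= => /eqP.
have le_nu : beta * nu A x <= nu A x by rewrite ler_piMl.
by have := tnu1 x; lra.
Qed.

Lemma magnified_translation_left_ideal (R : realType) (S : semigroupType)
    (A : ifpair R S) (beta alpha : R) :
  if_left_ideal A -> translation_params A beta alpha ->
  if_left_ideal (magnified_translation beta alpha A).
Proof.
move=> [Aifs Ane Aleft] pars; split.
- exact: magnified_translation_ifs.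
- exact: magnified_translation_nonempty.
- case: pars => /andP[beta0 _] _ x y; case: (Aleft x y) => mu_le nu_le /=.
  by rewrite lerD2r lerB // ler_pM2l.
Qed.

Lemma left_regular_semiprime (R : realType) (S : semigroupType)
    (A : ifpair R S) :
  left_regular S -> if_left_ideal A -> if_semiprime A.
Proof.
move=> Sreg [_ _ Aleft] a; case: (Sreg a) => x ax.
by have := Aleft x (a * a)%g; rewrite -ax.
Qed.

Definition char_pair (R : realType) (S : Type) (L : set S) : ifpair R S :=
  IFPair (fun x => (`[< L x >])%:R) (fun x => (~~ `[< L x >])%:R).

(** A point of L has mu = 1, which excludes the empty pair. For y outside L the values 0 and 1 are
    extreme, so closure of L matters only for y in L. *)
Lemma char_pair_left_ideal (R : realType) (S : semigroupType) (L : set S) :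
  L !=set0 -> (forall x y, L y -> L (x * y)%g) ->
  if_left_ideal (char_pair R L).
Proof.
move=> [a La] Lmul; split.
- by move=> x /=; case: asboolP => _ /=; split; apply/andP; split; lra.
- by move=> [/(_ a) /= + _]; rewrite asboolT // => /eqP; rewrite oner_eq0.
- move=> x y /=; case: (asboolP (L y)) => [Ly|_] /=.
    by rewrite asboolT ?lexx //; exact: Lmul.
  by rewrite ler0n lern1 leq_b1.
Qed.

Lemma translation_params10 (R : realType) (S : semigroupType)
    (A : ifpair R S) :
  inhabited S -> is_ifs A -> translation_params A 1 0.
Proof.
move=> [a] Aifs; split; first by rewrite ltr01 lexx.
(* The point a supplies the non-empty range that [lb_le_inf] asks for. *)
rewrite lexx /=; apply: lb_le_inf; first by exists (1 * nu A a), a.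
by move=> _ [y _ <-]; case: (Aifs y) => _ /andP[nu0 _] _; rewrite mul1r.
Qed.

Theorem theorem3p19 (R : realType) (S : semigroupType)
    (S_nonempty : inhabited S) :
  left_regular S <->
  (forall A : ifpair R S, if_left_ideal A ->
   forall beta alpha : R, translation_params A beta alpha ->
   if_semiprime_left_ideal (magnified_translation beta alpha A)).
Proof.
split=> [Sreg A Aleft beta alpha pars|semiprime a].
  have tleft := magnified_translation_left_ideal Aleft pars.
  by split=> //; exact: left_regular_semiprime.
(* S may lack an identity, so a^2 need not lie in S a^2 and is adjoined by hand. *)
pose L : set S := [set y | y = (a * a)%g \/ exists x, y = (x * (a * a))%g].
have Lmul x y : L y -> L (x * y)%g.
  case=> [->|[z ->]]; right; first by exists x.
  by exists (x * z)%g; rewrite mulgA.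
have Lleft : if_left_ideal (char_pair R L).
  by apply: char_pair_left_ideal Lmul; exists (a * a)%g; left.
have pars : translation_params (char_pair R L) 1 0.
  by apply: translation_params10 => //; case: Lleft.
have [_ /(_ a) [+ _]] := semiprime _ Lleft _ _ pars.
(* As a^2 lies in L, the mu inequality becomes 1 <= mu a, which would read 1 <= 0 if a were outside
   L. *)
rewrite /= !mul1r !addr0 (asboolT (P := L (a * a)%g)); last by left.
case: asboolP => [|_]; last by rewrite ler10.
by move=> [aa|//] _; exists a; rewrite -aa.
Qed.
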